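(* Let $A$ be a Noetherian local ring with maximal ideal $\mathfrak m_A$ and let $M$ be an $A$-module of finite type. (1) $M$ is free over $A$ if and only if there exists a strongly $M$-independent sequence of length $\operatorname{edim}(A)$ of elements of $\mathfrak m_A$. (2) $M/\mathfrak m_A^2M$ is free over $A/\mathfrak m_A^2$ if and only if there exists an $M$-independent sequence of length $\operatorname{edim}(A)$ of elements of $\mathfrak m_A$.
   Context: $\operatorname{edim}(A)$ is the embedding dimension of $A$, i.e. the minimal number of generators of $\mathfrak m_A$. A sequence $x_1,\dots,x_n$ of elements of $A$ is $M$-independent if for all $m_1,\dots,m_n\in M$, $\sum_i x_im_i=0$ implies $m_i\in(x_1,\dots,x_n)M$ for every $i$. For an ideal $I$ of the Noetherian local ring $A$ with a minimal system of generators $(x_1,\dots,x_n)$, $R_I(M)$ denotes the submodule of $M$ generated by all the elements $m_i\in M$ occurring in relations $x_1m_1+\dots+x_nm_n=0$; it does not depend on the choice of the minimal system of generators. An ideal $I$ is strongly $M$-independent if $R_{I^i}(M)\subset IM$ for every integer $i\ge 1$. A sequence is strongly $M$-independent if it is a minimal system of generators of a strongly $M$-independent ideal. *)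

(* Defs.v *)
From HB Require Import structures.
From mathcomp Require Import all_boot all_order all_algebra.
From mathcomp Require Import generic_quotient ring_quotient.
From mathcomp Require Import boolp classical_sets.

Set Implicit Arguments.
Unset Strict Implicit.
Unset Printing Implicit Defensive.

Import GRing.Theory.
Local Open Scope ring_scope.
Local Open Scope quotient_scope.
Local Open Scope classical_set_scope.

Section Modules.
Context (R : comNzRingType).

Definition span (V : lmodType R) (X : set V) : set V :=
  [set v | exists s : seq (R * V),
     (forall p, p \in s -> X p.2) /\ v = \sum_(p <- s) p.1 *: p.2].

Definition lin_indep (V : lmodType R) (X : set V) : Prop :=
  forall (s : seq V) (a : V -> R), uniq s -> (forall v, v \in s -> X v) ->
    \sum_(v <- s) a v *: v = 0 -> forall v, v \in s -> a v = 0.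

Definition free_module (V : lmodType R) : Prop :=
  exists B : set V, lin_indep B /\ span B = setT.

Definition fin_gen_module (V : lmodType R) : Prop :=
  exists s : seq V, span [set` s] = setT.

(* I V, for a subset V of a module: the submodule generated by the products. *)
Definition smul (V : lmodType R) (I : set R) (N : set V) : set V :=
  span [set a *: v | a in I & v in N].

End Modules.

Section Ideals.
Context (A : comNzRingType).

(* Possibly improper, unlike the library's [idealr_closed]. *)
Definition is_ideal (I : set A) : Prop := submod_closed (in_set I : {pred A^o}).

Definition is_proper_ideal (I : set A) : Prop := idealr_closed (in_set I).

Definition ideal_span (X : set A) : set A := @span A A^o X.

Definition ideal_mul (I J : set A) : set A := @smul A A^o I J.

(* I^0 is the unit ideal. *)
Definition ideal_pow (I : set A) (n : nat) : set A := iter n (ideal_mul I) setT.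

Definition noetherian : Prop :=
  forall I : set A, is_ideal I -> exists s : seq A, I = ideal_span [set` s].

Definition maximal_ideal (m : set A) : Prop :=
  is_proper_ideal m /\ forall J, is_proper_ideal J -> m `<=` J -> J = m.

Definition local_ring (m : set A) : Prop :=
  maximal_ideal m /\ forall J, maximal_ideal J -> J = m.

Definition generators (n : nat) (x : 'I_n -> A) (I : set A) : Prop :=
  I = ideal_span (range x).

(* No term of the system can be omitted. *)
Definition min_generators (n : nat) (x : 'I_n -> A) (I : set A) : Prop :=
  generators x I /\ forall j, I <> ideal_span (x @` [set i | i != j]).

(* Junk value 0 when I is not finitely generated. *)
Definition min_ngen (I : set A) : nat :=
  xget 0%N [set n | (exists x : 'I_n -> A, generators x I) /\
    forall k (y : 'I_k -> A), generators y I -> (n <= k)%N].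

(* To be applied to the maximal ideal of a local ring. *)
Definition edim (m : set A) : nat := min_ngen m.

End Ideals.

Section Independence.
Context (A : comNzRingType) (M : lmodType A).

Definition indep_seq (n : nat) (x : 'I_n -> A) : Prop :=
  forall w : 'I_n -> M, \sum_i x i *: w i = 0 ->
    forall i, smul (ideal_span (range x)) [set: M] (w i).

(* R_I(M).  Over a Noetherian local ring all minimal systems of generators x
   of I give the same submodule, so collecting the relations of all of them
   amounts to fixing any one. *)
Definition rel_submod (I : set A) : set M :=
  span [set v | exists (n : nat) (x : 'I_n -> A) (w : 'I_n -> M),
    [/\ min_generators x I, \sum_i x i *: w i = 0 & range w v]].

Definition strongly_indep_ideal (I : set A) : Prop :=
  is_ideal I /\
  forall i, (1 <= i)%N -> rel_submod (ideal_pow I i) `<=` smul I [set: M].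

Definition strongly_indep_seq (n : nat) (x : 'I_n -> A) : Prop :=
  exists I, min_generators x I /\ strongly_indep_ideal I.

End Independence.

Lemma span0 (R : comNzRingType) (V : lmodType R) (X : set V) : span X 0.
Proof. by exists [::]; split=> //; rewrite big_nil. Qed.

Lemma spanP (R : comNzRingType) (V : lmodType R) (X : set V) a u v :
  span X u -> span X v -> span X (a *: u + v).
Proof.
move=> [s [sX ->]] [t [tX ->]].
exists ([seq (a * p.1, p.2) | p <- s] ++ t); split.
  move=> p; rewrite mem_cat => /orP[/mapP[q qs ->]|/tX//]; exact: sX qs.
rewrite big_cat big_map scaler_sumr; congr (_ + _).
by apply: eq_bigr => p _; rewrite scalerA.
Qed.

Lemma spanZ (R : comNzRingType) (V : lmodType R) (X : set V) a u :
  span X u -> span X (a *: u).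
Proof. by move=> Xu; rewrite -[_ *: _]addr0; apply: spanP => //; exact: span0. Qed.

Lemma sub_span (R : comNzRingType) (V : lmodType R) (X : set V) u :
  X u -> span X u.
Proof.
move=> Xu; exists [:: (1, u)]; split; last by rewrite big_seq1 scale1r.
by move=> p; rewrite inE => /eqP->.
Qed.

Section Quotient.
Context (A : comNzRingType) (J : set A).

(* These predicates and the quotients carry the proof that J is a proper ideal,
   so that the algebraic structures can be attached to them. *)
Definition ideal_pred (hJ : is_proper_ideal J) : {pred A} := in_set J.

HB.instance Definition _ (hJ : is_proper_ideal J) :=
  isIdealr.Build A (ideal_pred hJ) hJ.

Definition quot_ring (hJ : is_proper_ideal J) : comNzRingType :=
  {ideal_quot (ideal_pred hJ)}.

Context (M : lmodType A).

Definition smul_pred (hJ : is_proper_ideal J) : {pred M} :=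
  in_set (smul J [set: M]).

Lemma smul_pred_zmod_closed (hJ : is_proper_ideal J) :
  zmod_closed (smul_pred hJ).
Proof.
split=> [|u v]; rewrite !inE; first exact: span0.
by move=> Xu Xv; rewrite addrC -scaleN1r; apply: spanP.
Qed.

HB.instance Definition _ (hJ : is_proper_ideal J) :=
  GRing.isZmodClosed.Build M (smul_pred hJ) (smul_pred_zmod_closed hJ).

(* The module M/JM over A/J. *)
Definition quot_mod (hJ : is_proper_ideal J) : Type :=
  Quotient.quot (smul_pred hJ).

HB.instance Definition _ (hJ : is_proper_ideal J) :=
  GRing.Zmodule.on (quot_mod hJ).

Context (hJ : is_proper_ideal J).
Let Q := Quotient.quot (smul_pred hJ).
Let B := {ideal_quot (ideal_pred hJ)}.

Definition quot_scale (b : quot_ring hJ) (q : quot_mod hJ) : quot_mod hJ :=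
  \pi_Q (repr (b : B) *: repr (q : Q)).

Lemma quot_scale_pi (a : A) (v : M) :
  quot_scale (\pi_B a) (\pi_Q v) = \pi_Q (a *: v).
Proof.
apply/eqP; rewrite -Quotient.idealrBE inE.
set b := repr _; set w := repr _.
have Jab : J (b - a).
  have : b - a \in ideal_pred hJ by rewrite Quotient.idealrBE reprK.
  by rewrite inE.
have JMwv : smul J [set: M] (w - v).
  have : w - v \in smul_pred hJ by rewrite Quotient.idealrBE reprK.
  by rewrite inE.
have -> : b *: w - a *: v = a *: (w - v) + (b - a) *: w.
  by rewrite scalerBr scalerBl [RHS]addrC addrA addrNK.
by apply: spanP => //; apply: sub_span; exists (b - a) => //; exists w.
Qed.

Lemma quot_scaleA (b c : quot_ring hJ) (q : quot_mod hJ) :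
  quot_scale b (quot_scale c q) = quot_scale (b * c) q.
Proof.
rewrite -[b](@reprK _ B) -[c](@reprK _ B) -[q](@reprK _ Q).
rewrite -[_ * _](rmorphM (\pi_B : A -> quot_ring hJ)).
by rewrite !quot_scale_pi scalerA.
Qed.

Lemma quot_scale1 : left_id 1 quot_scale.
Proof.
move=> q; rewrite -[q](@reprK _ Q) -[1](rmorph1 (\pi_B : A -> quot_ring hJ)).
by rewrite quot_scale_pi scale1r.
Qed.

Lemma quot_scaleDr : right_distributive quot_scale +%R.
Proof.
move=> b p q; rewrite -[b](@reprK _ B) -[p](@reprK _ Q) -[q](@reprK _ Q).
rewrite -[_ + _ in LHS](raddfD (\pi_Q : M -> quot_mod hJ)) !quot_scale_pi.
by rewrite scalerDr; exact: raddfD.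
Qed.

Lemma quot_scaleDl (q : quot_mod hJ) :
  {morph quot_scale^~ q : b c / b + c}.
Proof.
move=> b c /=; rewrite -[b](@reprK _ B) -[c](@reprK _ B) -[q](@reprK _ Q).
rewrite -[_ + _ in LHS](raddfD (\pi_B : A -> quot_ring hJ)) !quot_scale_pi.
by rewrite scalerDl; exact: raddfD.
Qed.

HB.instance Definition _ := GRing.Zmodule_isLmodule.Build
  (quot_ring hJ) (quot_mod hJ) quot_scaleA quot_scale1 quot_scaleDr quot_scaleDl.

Definition quot_ring_pi (a : A) : quot_ring hJ := \pi_B a.
Definition quot_mod_pi (v : M) : quot_mod hJ := \pi_Q v.

Lemma quot_ring_pi_zmod_morphism : zmod_morphism quot_ring_pi.
Proof. exact: (raddfB (\pi_B : A -> B)). Qed.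

Lemma quot_ring_pi_monoid_morphism : monoid_morphism quot_ring_pi.
Proof.
split; [exact: (rmorph1 (\pi_B : A -> B)) | exact: (rmorphM (\pi_B : A -> B))].
Qed.

Lemma quot_ring_pi_surj (b : quot_ring hJ) : exists a, quot_ring_pi a = b.
Proof. exists (repr (b : B)); exact: reprK. Qed.

Lemma quot_ring_pi_eq0 (a : A) : quot_ring_pi a = 0 <-> J a.
Proof.
have e : (quot_ring_pi a == 0) = (a \in ideal_pred hJ).
  rewrite -[a in RHS]subr0 Quotient.idealrBE.
  by rewrite [X in _ = (_ == X)](raddf0 (\pi_B : A -> B)).
by split=> [/eqP | h]; [|apply/eqP]; rewrite e inE.
Qed.

Lemma quot_mod_pi_zmod_morphism : zmod_morphism quot_mod_pi.
Proof. exact: (raddfB (\pi_Q : M -> Q)). Qed.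

Lemma quot_mod_piZ (a : A) (v : M) :
  quot_mod_pi (a *: v) = quot_ring_pi a *: quot_mod_pi v.
Proof. by rewrite [RHS]quot_scale_pi. Qed.

Lemma quot_mod_pi_surj (q : quot_mod hJ) : exists v, quot_mod_pi v = q.
Proof. exists (repr (q : Q)); exact: reprK. Qed.

Lemma quot_mod_pi_eq0 (v : M) : quot_mod_pi v = 0 <-> smul J [set: M] v.
Proof.
have e : (quot_mod_pi v == 0) = (v \in smul_pred hJ).
  rewrite -[v in RHS]subr0 Quotient.idealrBE.
  by rewrite [X in _ = (_ == X)](raddf0 (\pi_Q : M -> Q)).
by split=> [/eqP | h]; [|apply/eqP]; rewrite e inE.
Qed.

End Quotient.

HB.instance Definition _ (A : comNzRingType) (J : set A)
    (hJ : is_proper_ideal J) :=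
  GRing.isZmodMorphism.Build A (quot_ring hJ) (@quot_ring_pi A J hJ)
    (@quot_ring_pi_zmod_morphism A J hJ).
HB.instance Definition _ (A : comNzRingType) (J : set A)
    (hJ : is_proper_ideal J) :=
  GRing.isMonoidMorphism.Build A (quot_ring hJ) (@quot_ring_pi A J hJ)
    (@quot_ring_pi_monoid_morphism A J hJ).
HB.instance Definition _ (A : comNzRingType) (J : set A) (M : lmodType A)
    (hJ : is_proper_ideal J) :=
  GRing.isZmodMorphism.Build M (quot_mod M hJ) (@quot_mod_pi A J M hJ)
    (@quot_mod_pi_zmod_morphism A J M hJ).

Lemma maximal_ideal_sqr_proper (A : comNzRingType) (m : set A) :
  maximal_ideal m -> is_proper_ideal (ideal_pow m 2).
Proof.
move=> [[m0 m1 mP] _].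
have sub v : ideal_pow m 2 v -> m v.
  move=> [s [+ ->]]; elim: s => [_|p s IHs sP].
    by rewrite big_nil; rewrite inE in m0.
  rewrite big_cons; have [a ma [b _ pE]] := sP p (mem_head p s).
  have ms : m (\sum_(q <- s) q.1 *: (q.2 : A^o)).
    by apply: IHs => q qs; apply: sP; rewrite inE qs orbT.
  have -> : p.1 *: (p.2 : A^o) = p.1 * b * a by rewrite -pE [RHS]mulrAC -mulrA.
  rewrite -in_setE; apply: mP; by rewrite in_setE.
split.
- by rewrite inE; exact: span0.
- by apply: contra m1; rewrite !inE => /sub.
- move=> a u v; rewrite !inE; exact: (@spanP A A^o).
Qed.

(* Main.v *)
(* Let n = edim A, let y generate m_A and let x = C y be M-independent, both of
   length n.  Write r_i for the wedge product by the i-th row of C and d for the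
   Koszul differential of y on the exterior algebra of A^n tensored with M, so
   that d r_i + r_i d = x_i.  If eta has degree 1 and d eta = 0, then
   r_1 ... r_n eta = 0 for degree reasons, and applying d strips the r_i one by
   one: eta lies in the image of d up to (x)M.

   Let e be a minimal system of generators of M.  A relation sum_k c_k e_k = 0
   has c_k = sum_j y_j a_jk, and the w_j = sum_k a_jk e_k form a Koszul cycle;
   correcting the a_jk by the boundary just found leaves the c_k unchanged modulo
   m_A (x) and turns each (a_jk)_k into a relation again.  So every c_k lies in
   m_A^2, which gives (2), and iterating puts c_k in (x) + m_A^t for all t, hence
   in I = (x) by Krull: M/IM is free over A/I.  If moreover I is strongly
   M-independent, then c_k in I^t implies c_k in I^(t+1), and Krull's theorem
   again yields c_k = 0, which gives (1). *)
From HB Require Import structures.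
Require Import Defs.
From mathcomp Require Import all_boot all_order all_algebra.
From mathcomp Require Import boolp classical_sets.

Set Implicit Arguments.
Unset Strict Implicit.
Unset Printing Implicit Defensive.

Import GRing.Theory.
(* all_algebra has its own [span]. *)
Import Defs.
Local Open Scope ring_scope.
Local Open Scope classical_set_scope.

(** * Spans of finite families, and products of an ideal with a submodule *)

Section Spans.
Context (R : comNzRingType) (V : lmodType R).
Implicit Types (X N : set V).

Lemma span_ind X (P : V -> Prop) : P 0 ->
  (forall a u v, X u -> P v -> P (a *: u + v)) -> forall v, span X v -> P v.
Proof.
move=> P0 PS v [s [+ ->]]; elim: s => [|p s IHs] sX; first by rewrite big_nil.
rewrite big_cons; apply: PS; first exact: sX (mem_head _ _).
by apply: IHs => q qs; apply: sX; rewrite inE qs orbT.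
Qed.

Lemma spanD X u v : span X u -> span X v -> span X (u + v).
Proof. by move=> Xu Xv; rewrite -[u]scale1r; exact: spanP. Qed.

Lemma span_sum (I : Type) (r : seq I) (P : pred I) (F : I -> V) X :
  (forall i, P i -> span X (F i)) -> span X (\sum_(i <- r | P i) F i).
Proof.
by move=> XF; elim/big_ind: _ => //; [exact: span0 | exact: spanD].
Qed.

Lemma span_min X Y : X `<=` span Y -> span X `<=` span Y.
Proof.
move=> XY; apply: span_ind => [|a u v /XY Yu Yv]; [exact: span0|exact: spanP].
Qed.

Lemma span_mono X Y : X `<=` Y -> span X `<=` span Y.
Proof. by move=> XY; apply: span_min => u /XY; exact: sub_span. Qed.

Lemma span_rangeP n (e : 'I_n -> V) v :
  span (range e) v <-> exists a : 'I_n -> R, v = \sum_k a k *: e k.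
Proof.
split; last first.
  by move=> [a ->]; apply: span_sum => k _; apply/spanZ/sub_span; exists k.
move: v; apply: span_ind => [|a u v [k _ <-] [b ->]].
  by exists (fun=> 0); rewrite big1 // => k _; rewrite scale0r.
exists (fun i => (if i == k then a else 0) + b i).
under [RHS]eq_bigr do rewrite scalerDl.
rewrite big_split; congr (_ + _).
rewrite (bigD1 k) //= eqxx big1 ?addr0 // => i /negPf ->.
by rewrite scale0r.
Qed.

End Spans.

Lemma ideal_span_rangeP (R : comNzRingType) n (x : 'I_n -> R) b :
  ideal_span (range x) b <-> exists c : 'I_n -> R, b = \sum_i c i * x i.
Proof. exact: (@span_rangeP R R^o). Qed.

Section Products.
Context (R : comNzRingType) (V : lmodType R).
Implicit Types (X N : set V).

(** The hypothesis on [N] makes it a submodule, so the coefficients of an element of the ideal can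
    be absorbed into [N], leaving only the [x i]. *)
Lemma smul_rangeP n (x : 'I_n -> R) N u : span N `<=` N ->
  smul (ideal_span (range x)) N u <->
  exists v : 'I_n -> V, (forall i, N (v i)) /\ u = \sum_i x i *: v i.
Proof.
move=> NN; split; last first.
  move=> [v [Nv ->]]; apply: span_sum => i _; apply: sub_span.
  by exists (x i); [apply: (@sub_span R R^o); exists i | exists (v i)].
move: u; apply: span_ind => [|a u v [b Xb [w Nw <-]] [c [Nc ->]]].
  exists (fun=> 0); split=> [i|]; first exact/NN/span0.
  by rewrite big1 // => i _; rewrite scaler0.
have /ideal_span_rangeP[d ->] := Xb.
exists (fun i => (a * d i) *: w + c i); split=> [i|].
  by apply: NN; apply: spanP; exact: sub_span.
rewrite scaler_suml scaler_sumr -big_split; apply: eq_bigr => i _ /=.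
by rewrite scalerDr !scalerA mulrA mulrC.
Qed.

Lemma smul_rangeTP n (x : 'I_n -> R) (u : V) :
  smul (ideal_span (range x)) setT u <->
  exists v : 'I_n -> V, u = \sum_i x i *: v i.
Proof.
rewrite (smul_rangeP x (N := setT) u) //; split; first by move=> [v [_ ->]]; exists v.
by move=> [v ->]; exists v.
Qed.

Lemma smul_gen r (e : 'I_r -> V) (I : set R) u :
  span (range e) = setT -> @span R R^o I `<=` I -> smul I setT u ->
  exists b : 'I_r -> R, (forall k, I (b k)) /\ u = \sum_k b k *: e k.
Proof.
move=> eT II; move: u; apply: span_ind => [|a u v [b Ib [w _ <-]] [c [Ic ->]]].
  exists (fun=> 0); split=> [i|]; first exact/II/span0.
  by rewrite big1 // => i _; rewrite scale0r.
have /span_rangeP[d ->] : span (range e) w by rewrite eT.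
exists (fun k => (a * d k) * b + c k); split=> [k|].
  apply: II; apply: (@spanP R R^o); exact: sub_span.
rewrite !scaler_sumr -big_split; apply: eq_bigr => i _ /=.
by rewrite scalerDl !scalerA mulrAC -mulrA [b * _]mulrC mulrA.
Qed.

End Products.

(** * Independence and the Koszul differential *)

Section Koszul.
Context (A : comNzRingType).

(** Independence with membership in (x)E spelled out. The module is a parameter because independence
    is carried from [M] to its exterior algebra. *)
Definition indep_on n (x : 'I_n -> A) (E : lmodType A) : Prop :=
  forall w : 'I_n -> E, \sum_i x i *: w i = 0 ->
    forall i, exists v : 'I_n -> E, w i = \sum_l x l *: v l.

Lemma pair_sum (I : Type) (r : seq I) (E F : nmodType) (u : I -> E) (v : I -> F) :
  \sum_(i <- r) (u i, v i) = (\sum_(i <- r) u i, \sum_(i <- r) v i).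
Proof. by elim: r => [|i r IHr]; rewrite ?big_nil // !big_cons IHr. Qed.

Lemma indep_on_prod n (x : 'I_n -> A) (E F : lmodType A) :
  indep_on x E -> indep_on x F -> indep_on x (E * F)%type.
Proof.
move=> xE xF w w0 i.
have wE : \sum_i x i *: w i = (\sum_i x i *: (w i).1, \sum_i x i *: (w i).2).
  by rewrite -pair_sum; apply: eq_bigr => j _; case: (w j).
move: w0; rewrite wE => -[w1 w2].
have [u uE] := xE _ w1 i; have [v vE] := xF _ w2 i.
exists (fun l => (u l, v l)); rewrite [w i]surjective_pairing uE vE.
by rewrite -pair_sum.
Qed.

(* Descent along the rows: with xi the product r_S eta over a suffix S of the
   rows, applying d to r_i xi in dE + IE and comparing the coefficients of x_i
   gives xi in dE + IE. *)
Lemma homotopy_descent n (x : 'I_n -> A) (E : lmodType A)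
    (d : {linear E -> E}) (r : 'I_n -> {linear E -> E}) (eta : E) :
  indep_on x E -> (forall f, d (d f) = 0) ->
  (forall i f, d (r i f) + r i (d f) = x i *: f) ->
  d eta = 0 -> foldr (fun i => r i) eta (enum 'I_n) = 0 ->
  exists (u : E) (v : 'I_n -> E), eta = d u + \sum_i x i *: v i.
Proof.
move=> xE dd dr deta.
(* Since [g] vanishes outside [S], the coefficient of x_i for the row i stripped next contains no
   r_i (g i) and reduces to xi - d (v i). *)
have dxi (S : seq 'I_n) : exists g : 'I_n -> E,
    (forall i, i \notin S -> g i = 0) /\
    d (foldr (fun i => r i) eta S) = \sum_i x i *: g i.
  elim: S => [|i S [g [g0 gE]]] /=.
    by exists (fun=> 0); split=> //; rewrite big1 // => i _; rewrite scaler0.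
  exists (fun j => (if j == i then foldr (fun i => r i) eta S else 0) - r i (g j)).
  split=> [j|].
    by rewrite inE negb_or => /andP[/negPf-> /g0->]; rewrite linear0 subr0.
  rewrite -[LHS](addrK (r i (d (foldr (fun i => r i) eta S)))) dr gE.
  under [RHS]eq_bigr do rewrite scalerBr.
  rewrite sumrB; congr (_ - _).
    rewrite (bigD1 i) //= eqxx big1 ?addr0 // => j /negPf->.
    by rewrite scaler0.
  by rewrite linear_sum; apply: eq_bigr => j _; rewrite linearZ.
move=> top0.
have : exists u v, foldr (fun i => r i) eta (enum 'I_n) = d u + \sum_i x i *: v i.
  exists 0, (fun=> 0); rewrite top0 linear0 big1 ?addr0 // => i _.
  by rewrite scaler0.
elim: (enum 'I_n) (enum_uniq 'I_n) => // {top0} i S IHS /= /andP[iS uS].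
move=> [u [v uv]]; apply: IHS => //.
set xi := foldr _ _ _ in uv *.
have [g [g0 gE]] := dxi S.
pose w j := (if j == i then xi else 0) - r i (g j) - d (v j).
have w0 : \sum_j x j *: w j = 0.
  under eq_bigr do rewrite !scalerBr.
  rewrite !sumrB [X in X - _ - _](bigD1 i) //= eqxx big1 ?addr0; last first.
    by move=> j /negPf->; rewrite scaler0.
  have -> : \sum_j x j *: r i (g j) = r i (d xi).
    by rewrite gE linear_sum; apply: eq_bigr => j _; rewrite linearZ.
  rewrite -(dr i xi) addrK uv linearD dd add0r linear_sum.
  by rewrite -sumrB big1 // => j _; rewrite linearZ subrr.
have [v' v'E] := xE w w0 i.
exists (v i), v'; rewrite -v'E /w eqxx (g0 _ iS) linear0 subr0 addrC subrK.
by [].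
Qed.

(** * The exterior algebra of A^n tensored with [M], by recursion on n *)

Context (M : lmodType A).

(* [ext n] is the exterior algebra of A^n tensored with M; the pair (f, g)
   stands for f + e_0 /\ g. *)
Fixpoint ext (n : nat) : lmodType A :=
  if n is n'.+1 then (ext n' * ext n')%type else M.

(* Contraction by y, i.e. the Koszul differential. *)
Fixpoint contract n : ('I_n -> A) -> ext n -> ext n :=
  if n is n'.+1 then fun y (f : ext n' * ext n') =>
    let y' i := y (lift ord0 i) in
    (contract y' f.1 + y ord0 *: f.2, - contract y' f.2)
  else fun _ _ => 0.

(** Left exterior multiplication by the vector [r]; the minus sign comes from moving the tail of [r]
    past e_0. *)
Fixpoint wedge n : ('I_n -> A) -> ext n -> ext n :=
  if n is n'.+1 then fun r (f : ext n' * ext n') =>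
    let r' i := r (lift ord0 i) in
    (wedge r' f.1, r ord0 *: f.1 - wedge r' f.2)
  else fun _ _ => 0.

Lemma contract_linear n (y : 'I_n -> A) : linear (contract y).
Proof.
elim: n y => [|n IHn] y a; first by move=> f g /=; rewrite scaler0 addr0.
move=> [f0 f1] [g0 g1]; pose y' i := y (lift ord0 i); congr pair.
  change (contract y' (a *: f0 + g0) + y ord0 *: (a *: f1 + g1) =
    a *: (contract y' f0 + y ord0 *: f1) + (contract y' g0 + y ord0 *: g1)).
  by rewrite IHn scalerDr scalerDr !scalerA [a * _]mulrC addrACA.
change (- contract y' (a *: f1 + g1) =
  a *: (- contract y' f1) + - contract y' g1).
by rewrite IHn opprD scalerN.
Qed.

Lemma wedge_linear n (r : 'I_n -> A) : linear (wedge r).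
Proof.
elim: n r => [|n IHn] r a; first by move=> f g /=; rewrite scaler0 addr0.
move=> [f0 f1] [g0 g1]; pose r' i := r (lift ord0 i); congr pair.
  exact: (IHn r').
change (r ord0 *: (a *: f0 + g0) - wedge r' (a *: f1 + g1) =
  a *: (r ord0 *: f0 - wedge r' f1) + (r ord0 *: g0 - wedge r' g1)).
by rewrite IHn scalerBr scalerDr !scalerA [a * _]mulrC opprD addrACA.
Qed.

HB.instance Definition _ n (y : 'I_n -> A) :=
  GRing.isLinear.Build A (ext n) (ext n) _ (contract y) (contract_linear y).
HB.instance Definition _ n (y : 'I_n -> A) :=
  GRing.isLinear.Build A (ext n) (ext n) _ (wedge y) (wedge_linear y).

Lemma contract_contract n (y : 'I_n -> A) f : contract y (contract y f) = 0.
Proof.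
elim: n y f => [|n IHn] y //= [f0 f1] /=; congr pair.
  by rewrite linearD linearZ /= IHn add0r scalerN subrr.
by rewrite linearN /= IHn !oppr0.
Qed.

(** Contraction is an antiderivation, so its anticommutator with exterior multiplication by [r] is
    the pairing of [r] with [y]. *)
Lemma contract_wedge n (y r : 'I_n -> A) f :
  contract y (wedge r f) + wedge r (contract y f) = (\sum_i r i * y i) *: f.
Proof.
elim: n y r f => [|n IHn] y r; first by move=> f /=; rewrite big_ord0 addr0 scale0r.
move=> [f0 f1]; rewrite big_ord_recl.
pose y' i := y (lift ord0 i); pose r' i := r (lift ord0 i).
set c := \sum_i _; congr pair.
  change (contract y' (wedge r' f0) + y ord0 *: (r ord0 *: f0 - wedge r' f1)
    + wedge r' (contract y' f0 + y ord0 *: f1) = (r ord0 * y ord0 + c) *: f0).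
  rewrite [in RHS]scalerDl -IHn [wedge r' (_ + _)]linearD linearZ /= scalerBr.
  by rewrite !scalerA [y _ * _]mulrC addrACA subrK addrC.
change (- contract y' (r ord0 *: f0 - wedge r' f1) +
    (r ord0 *: (contract y' f0 + y ord0 *: f1) - wedge r' (- contract y' f1))
  = (r ord0 * y ord0 + c) *: f1).
rewrite [in RHS]scalerDl -IHn linearN [contract y' (_ - _)]linearB linearZ /=.
rewrite scalerDr !scalerA opprK opprB.
by rewrite addrA addrA subrK addrAC addrC.
Qed.

(** Vanishing of all components of exterior degree below [k]. The factor e_0 accounts for one
    degree, hence [k.-1]; truncation at 0 is harmless because [k = 0] imposes nothing. *)
Fixpoint in_deg_ge n (k : nat) : ext n -> Prop :=
  if n is n'.+1 then fun f : ext n' * ext n' =>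
    in_deg_ge k f.1 /\ in_deg_ge k.-1 f.2
  else fun f => (0 < k)%N -> f = 0.

Lemma in_deg_ge_lin n k a (f g : ext n) :
  in_deg_ge k f -> in_deg_ge k g -> in_deg_ge k (a *: f + g).
Proof.
elim: n k f g => [|n IHn] k /= => [f g f0 g0 k0|].
  by rewrite f0 // g0 // scaler0 addr0.
by move=> [f0 f1] [g0 g1] [p0 p1] [q0 q1]; split; apply: IHn.
Qed.

Lemma in_deg_ge0 n (f : ext n) : in_deg_ge 0 f.
Proof. by elim: n f => //= n IHn [f0 f1]; split; apply: IHn. Qed.

Lemma in_deg_geS n k (f : ext n) : in_deg_ge k.+1 f -> in_deg_ge k f.
Proof.
elim: n k f => [|n IHn] k /= => [f f0 _|[f0 f1] [p0 p1]]; first exact: f0.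
split; first exact: IHn.
by case: k p1 {p0} => [|k] p1; [exact: in_deg_ge0 | exact: IHn].
Qed.

Lemma in_deg_ge_zero n k : in_deg_ge k (0 : ext n).
Proof. by elim: n k => //= n IHn k; split; exact: IHn. Qed.

Lemma in_deg_ge_wedge n k (r : 'I_n -> A) (f : ext n) :
  in_deg_ge k f -> in_deg_ge k.+1 (wedge r f).
Proof.
elim: n k r f => [|n IHn] k r //= [f0 f1] /= [p0 p1]; split; first exact: IHn.
apply: in_deg_ge_lin => //; rewrite -[- _]scaleN1r -[_ *: _]addr0.
case: k p0 p1 => [|k] p0 p1; first exact: in_deg_ge0.
by apply: in_deg_ge_lin; [exact: IHn | exact: in_deg_ge_zero].
Qed.

Lemma in_deg_ge_top n (f : ext n) : in_deg_ge n.+1 f -> f = 0.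
Proof.
elim: n f => [|n IHn] /= => [f f0|[f0 f1] [p0 p1]]; first exact: f0.
by congr pair; apply: IHn => //; exact: in_deg_geS.
Qed.

(** [ext0] and [ext1] embed the parts of degree 0 and 1, that is M and M^n; [coef0] and [coef1] are
    the projections back. *)
Fixpoint ext0 n : M -> ext n :=
  if n is n'.+1 then fun v => (ext0 n' v, 0) else id.

Fixpoint ext1 n : ('I_n -> M) -> ext n :=
  if n is n'.+1 then fun w => (ext1 (fun i => w (lift ord0 i)), ext0 n' (w ord0))
  else fun=> 0.

Fixpoint coef0 n : ext n -> M :=
  if n is n'.+1 then fun f : ext n' * ext n' => coef0 f.1 else id.

Fixpoint coef1 n : 'I_n -> ext n -> M :=
  if n is n'.+1 then fun i (f : ext n' * ext n') =>
    if unlift ord0 i is Some j then coef1 j f.1 else coef0 f.2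
  else fun _ _ => 0.

Lemma ext0_linear n : linear (@ext0 n).
Proof.
elim: n => [|n IHn] a u v //=; congr pair; first exact: IHn.
by change (0 = a *: 0 + 0 :> ext n); rewrite scaler0 addr0.
Qed.

Lemma coef0_linear n : linear (@coef0 n).
Proof. by elim: n => [|n IHn] a //= f g; exact: IHn. Qed.

Lemma coef1_linear n (i : 'I_n) : linear (coef1 i).
Proof.
elim: n i => [|n IHn] i a f g /=; first by rewrite scaler0 addr0.
by case: unliftP => [j|] _; [exact: IHn | exact: coef0_linear].
Qed.

HB.instance Definition _ n :=
  GRing.isLinear.Build A M (ext n) _ (@ext0 n) (@ext0_linear n).
HB.instance Definition _ n :=
  GRing.isLinear.Build A (ext n) M _ (@coef0 n) (@coef0_linear n).
HB.instance Definition _ n i :=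
  GRing.isLinear.Build A (ext n) M _ (@coef1 n i) (@coef1_linear n i).

Lemma coef0_ext0 n v : coef0 (ext0 n v) = v.
Proof. by elim: n. Qed.

Lemma coef1_ext1 n (w : 'I_n -> M) i : coef1 i (ext1 w) = w i.
Proof.
elim: n w i => [|n IHn] w i /=; first by case: i.
by case: unliftP => [j|] ->; rewrite ?IHn ?coef0_ext0.
Qed.

Lemma in_deg_ge_ext1 n (w : 'I_n -> M) : in_deg_ge 1 (ext1 w).
Proof. by elim: n w => //= n IHn w; split=> //; exact: in_deg_ge0. Qed.

Lemma contract_ext0 n (y : 'I_n -> A) v : contract y (ext0 n v) = 0.
Proof.
elim: n y => [|n IHn] y //=; congr pair; first by rewrite IHn scaler0 addr0.
by rewrite linear0 oppr0.
Qed.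

Lemma contract_ext1 n (y : 'I_n -> A) (w : 'I_n -> M) :
  contract y (ext1 w) = ext0 n (\sum_i y i *: w i).
Proof.
elim: n y w => [|n IHn] y w /=; first by rewrite big_ord0.
rewrite IHn contract_ext0 oppr0 big_ord_recl linearD linearZ /=.
by congr pair; rewrite addrC.
Qed.

Lemma coef0_contract n (y : 'I_n -> A) (f : ext n) :
  coef0 (contract y f) = \sum_i y i *: coef1 i f.
Proof.
elim: n y f => [|n IHn] y /=; first by rewrite big_ord0.
move=> [f0 f1]; rewrite linearD linearZ /= IHn big_ord_recl unlift_none addrC.
by congr (_ + _); apply: eq_bigr => i _; rewrite liftK.
Qed.

(** The degree 2 part of [f] is an antisymmetric matrix. Writing it as a matrix minus its transpose
    lets antisymmetry survive when the entries are later lifted to coordinates in A. *)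
Lemma coef1_contract n (y : 'I_n -> A) (f : ext n) :
  exists s : 'I_n -> 'I_n -> M, forall j,
    coef1 j (contract y f) = \sum_l y l *: (s j l - s l j).
Proof.
elim: n y f => [|n IHn] y /=; first by move=> _; exists (fun _ _ => 0) => -[].
move=> [f0 f1]; have [s sE] := IHn (fun i => y (lift ord0 i)) f0.
exists (fun j l => if unlift ord0 j is Some j' then
  if unlift ord0 l is Some l' then s j' l' else coef1 j' f1 else 0) => j.
rewrite big_ord_recl unlift_none /=.
case: unliftP => [j'|] _.
  rewrite linearD linearZ /= sE subr0 addrC; congr (_ + _).
  by apply: eq_bigr => l _; rewrite liftK.
rewrite linearN /= coef0_contract subr0 scaler0 add0r -sumrN.
by apply: eq_bigr => l _; rewrite liftK sub0r scalerN.
Qed.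

Lemma indep_on_ext m (x : 'I_m -> A) n : indep_on x M -> indep_on x (ext n).
Proof. by move=> xM; elim: n => //= n IHn; exact: indep_on_prod. Qed.

Lemma koszul_cycle n (x y : 'I_n -> A) (c : 'I_n -> 'I_n -> A) (w : 'I_n -> M) :
  (forall i, x i = \sum_j c i j * y j) -> indep_on x M ->
  \sum_j y j *: w j = 0 ->
  exists s : 'I_n -> 'I_n -> M, forall j, exists v : 'I_n -> M,
    w j = \sum_l y l *: (s j l - s l j) + \sum_i x i *: v i.
Proof.
move=> xE xM w0.
have cw i f : contract y (wedge (c i) f) + wedge (c i) (contract y f) = x i *: f.
  by rewrite contract_wedge xE.
(* Starting from degree 1, the n multiplications end in degree n + 1, where the exterior algebra is
   zero. *)
have top0 : foldr (fun i => wedge (c i)) (ext1 w) (enum 'I_n) = 0.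
  apply: in_deg_ge_top; rewrite -[X in in_deg_ge X.+1](size_enum_ord n).
  elim: (enum _) => [|i S IHS] /=; first exact: in_deg_ge_ext1.
  exact: in_deg_ge_wedge.
have dw0 : contract y (ext1 w) = 0 by rewrite contract_ext1 w0 linear0.
have [u [v uv]] := homotopy_descent (indep_on_ext (n := n) xM)
  (contract_contract y) cw dw0 top0.
have [s sE] := coef1_contract y u; exists s => j; exists (fun i => coef1 j (v i)).
rewrite -[w j](coef1_ext1 w j) uv linearD /= sE linear_sum; congr (_ + _).
by apply: eq_bigr => i _; rewrite linearZ.
Qed.

End Koszul.

(** * Ideals, from Zorn's lemma to Krull's intersection theorem *)

Section IdealTheory.
Context (A : comNzRingType).
Implicit Types (I J L : set A) (a b : A).

Lemma is_idealP I : is_ideal I <->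
  I 0 /\ forall a u v, I u -> I v -> I (a * u + v).
Proof.
split=> [[I0 IP]|[I0 IP]].
  split=> [|a u v Iu Iv]; first by rewrite inE in I0.
  by rewrite -in_setE; apply: (IP a u v); rewrite in_setE.
by split=> [|a u v]; rewrite !inE //; exact: IP.
Qed.

Lemma ideal_span_ideal (X : set A) : is_ideal (ideal_span X).
Proof.
by apply/is_idealP; split; [exact: (@span0 A A^o)|exact: (@spanP A A^o)].
Qed.

Section Ops.
Context (I : set A) (idI : is_ideal I).

Lemma ideal0 : I 0. Proof. by have /is_idealP[] := idI. Qed.

Lemma idealM a u : I u -> I (a * u).
Proof.
by have /is_idealP[I0 IP] := idI; move=> Iu; rewrite -[_ * _]addr0; exact: IP.
Qed.

Lemma idealD u v : I u -> I v -> I (u + v).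
Proof.
by have /is_idealP[I0 IP] := idI; move=> Iu Iv; rewrite -[u]mul1r; exact: IP.
Qed.

Lemma idealB u v : I u -> I v -> I (u - v).
Proof. by move=> Iu Iv; apply: idealD => //; rewrite -mulN1r; exact: idealM. Qed.

Lemma ideal_sum (T : Type) (r : seq T) (P : pred T) (F : T -> A) :
  (forall i, P i -> I (F i)) -> I (\sum_(i <- r | P i) F i).
Proof. by move=> IF; elim/big_ind: _ => //; [exact: ideal0 | exact: idealD]. Qed.

Lemma ideal_span_min (X : set A) : X `<=` I -> ideal_span X `<=` I.
Proof.
move=> XI; apply: (@span_ind A A^o) => [|a u v /XI Iu Iv]; first exact: ideal0.
by apply: idealD => //; exact: idealM.
Qed.

Lemma ideal_span_id : @span A A^o I `<=` I.
Proof. exact: ideal_span_min. Qed.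

End Ops.

Lemma ideal_pow_ideal I i : is_ideal (ideal_pow I i).
Proof.
case: i => [|i]; first by apply/is_idealP; split.
exact: ideal_span_ideal.
Qed.

Lemma ideal_powS I i a u : I a -> ideal_pow I i u -> ideal_pow I i.+1 (a * u).
Proof. by move=> Ia Iu; apply: (@sub_span A A^o); exists a => //; exists u. Qed.

Lemma ideal_pow1 I : is_ideal I -> ideal_pow I 1 = I.
Proof.
move=> idI; apply/seteqP; split=> [|a Ia].
  apply: ideal_span_min => // _ [a Ia [b _ <-]].
  by rewrite [_ *: _]mulrC; exact: idealM.
by rewrite -[a]mulr1; exact: ideal_powS.
Qed.

Lemma ideal_pow_mono I J i : I `<=` J -> ideal_pow I i `<=` ideal_pow J i.
Proof.
move=> IJ; elim: i => [|i IHi] //; apply: ideal_span_min.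
  exact: ideal_pow_ideal.
by move=> _ [a /IJ Ja [b /IHi Jb <-]]; exact: ideal_powS.
Qed.

Lemma proper_ideal I : is_proper_ideal I -> is_ideal I /\ ~ I 1.
Proof.
move=> [I0 I1 IP]; split; last by move=> /mem_set; apply/negP.
apply/is_idealP; split=> [|a u v Iu Iv]; rewrite -in_setE //.
by apply: IP; rewrite in_setE.
Qed.

Lemma proper_idealP I : is_ideal I -> ~ I 1 -> is_proper_ideal I.
Proof.
move=> /is_idealP[I0 IP] I1; split; first by rewrite inE.
  by apply/negP; rewrite inE.
by move=> a u v; rewrite !inE; exact: IP.
Qed.

(** Used with a = 1 to produce maximal ideals, and with a general a in Krull's theorem. *)
Lemma ideal_avoiding I a : is_ideal I -> ~ I a ->
  exists L, [/\ is_ideal L, I `<=` L, ~ L a &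
    forall J, is_ideal J -> L `<=` J -> ~ J a -> J = L].
Proof.
move=> idI Ia.
pose P L := L = set0 \/ [/\ is_ideal L, I `<=` L & ~ L a].
have [F FP Ftot|L [LP Lmax]] := @Zorn_bigcup A P.
  have [[X FX X0]|F0] := pselect (exists2 X, F X & X !=set0); last first.
    left; apply/seteqP; split=> // u [X FX Xu]; apply: F0; exists X => //.
    by exists u.
  right.
  have FI Y u : F Y -> Y u -> [/\ is_ideal Y, I `<=` Y & ~ Y a].
    by move=> /FP[->|].
  have [u Xu] := X0; have [idX IX Xa] := FI X u FX Xu.
  split; [|by move=> v Iv; exists X => //; exact: IX|]; last first.
    by move=> [Y FY Ya]; have [_ _] := FI Y a FY Ya.
  apply/is_idealP; split; first by exists X => //; exact: ideal0.
  move=> b v w [Y FY Yv] [Z FZ Zw].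
  have [idY _ _] := FI Y v FY Yv; have [idZ _ _] := FI Z w FZ Zw.
  have [YZ|ZY] := Ftot Y Z FY FZ.
    by exists Z => //; apply: idealD => //; apply: idealM => //; exact: YZ.
  by exists Y => //; apply: idealD => //; [exact: idealM|exact: ZY].
have L0 : L <> set0.
  move=> L0; apply: (Lmax I); last by right; split.
  rewrite L0; split=> // /(_ 0 (ideal0 idI)) //.
have [//|[idL IL La]] := LP.
exists L; split=> // J idJ LJ Ja; apply/seteqP; split=> //.
apply: contrapT => JL; apply: (Lmax J); first by split.
by right; split=> //; exact: subset_trans LJ.
Qed.

(** If a is not a unit, the ideal A a is proper, hence contained in a maximal ideal, which must be
    m. *)
Lemma local_unit m a : local_ring m -> ~ m a -> exists b, b * a = 1.
Proof.
move=> [_ m_uniq] ma; apply: contrapT => a_nu.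
pose I : set A := [set b * a | b in setT].
have idI : is_ideal I.
  apply/is_idealP; split; first by exists 0; rewrite ?mul0r.
  by move=> c _ _ [b _ <-] [d _ <-]; exists (c * b + d); rewrite ?mulrDl ?mulrA.
have [|L [idL IL L1 Lmax]] := @ideal_avoiding I 1 idI.
  by move=> [b _ ba]; apply: a_nu; exists b.
apply: ma; rewrite -(m_uniq L); first by apply: IL; exists 1; rewrite ?mul1r.
split=> [|J /proper_ideal[idJ J1] LJ]; first exact: proper_idealP.
exact: Lmax.
Qed.

(** The finitely many generators of the union all lie in one term of the chain. *)
Lemma noetherian_chain (F : nat -> set A) : noetherian A ->
  (forall t, is_ideal (F t)) -> (forall t, F t `<=` F t.+1) ->
  exists t, F t.+1 `<=` F t.
Proof.
move=> hN idF FS.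
have Fle s t : (s <= t)%N -> F s `<=` F t.
  elim: t => [|t IHt]; first by rewrite leqn0 => /eqP->.
  rewrite leq_eqVlt => /predU1P[->//|]; rewrite ltnS => /IHt st.
  exact: subset_trans (FS t).
have [|s sE] := hN (\bigcup_t F t).
  apply/is_idealP; split; first by exists 0%N => //; exact: ideal0.
  move=> a u v [i _ Fu] [j _ Fv]; exists (maxn i j) => //.
  apply: idealD => //; first by apply: idealM => //; exact: Fle (leq_maxl _ _) _ Fu.
  exact: Fle (leq_maxr _ _) _ Fv.
have [t st] : exists t, forall u, u \in s -> F t u.
  have: forall u, u \in s -> exists t, F t u.
    move=> u us; have [t _ Ft] : (\bigcup_t F t) u; last by exists t.
    by rewrite sE; exact: (@sub_span A A^o).
  elim: s {sE} => [_|u s IHs us]; first by exists 0%N.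
  have [t tP] := IHs (fun v vs => us v (mem_behead (s := u :: s) vs)).
  have [t' Ft'] := us u (mem_head _ _).
  exists (maxn t t') => v; rewrite inE => /predU1P[->|/tP Ftv].
    exact: Fle (leq_maxr _ _) _ Ft'.
  exact: Fle (leq_maxl _ _) _ Ftv.
exists t; apply: (@subset_trans _ (\bigcup_t F t)).
  by move=> u Fu; exists t.+1.
by rewrite sE; apply: ideal_span_min => // u; exact: st.
Qed.

(** Induction on the length strips the first letter [y j] of a word by passing from [I] to the colon
    ideal (I : y_j). *)
Lemma ideal_pow_words n (y : 'I_n -> A) I i : is_ideal I ->
  (forall w : seq 'I_n, size w = i -> I (\prod_(j <- w) y j)) ->
  ideal_pow (ideal_span (range y)) i `<=` I.
Proof.
elim: i I => [|i IHi] I idI Iw.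
  move=> a _; rewrite -[a]mulr1; apply: idealM => //.
  by have := Iw [::] erefl; rewrite big_nil.
apply: ideal_span_min => // _ [a /ideal_span_rangeP[c ->] [b Ib <-]].
rewrite /GRing.scale /= mulr_suml; apply: ideal_sum => // j _.
rewrite -mulrA; apply: idealM => //.
apply: (IHi [set b | I (y j * b)]) Ib => [|w wi /=].
  apply/is_idealP; split=> [|d u v Iu Iv] /=; first by rewrite mulr0; exact: ideal0.
  by rewrite mulrDr mulrCA; apply: idealD => //; exact: idealM.
by have := Iw (j :: w); rewrite big_cons; apply; rewrite /= wi.
Qed.

Lemma nilpotent_generators n (y : 'I_n -> A) I : is_ideal I ->
  (forall j, exists t, I (y j ^+ t)) ->
  exists i, ideal_pow (ideal_span (range y)) i `<=` I.
Proof.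
move=> idI /choice[t tP]; exists (\sum_j t j).+1; apply: ideal_pow_words => // w wE.
(* Pigeonhole: a word longer than the sum of the [t j] repeats some letter j at least [t j]
   times. *)
have [j tj] : exists j, (t j <= count_mem j w)%N.
  apply: contrapT => nt; have: (size w <= \sum_j t j)%N; last by rewrite wE ltnn.
  rewrite -sum1_size (partition_big id predT) //=; apply: leq_sum => j _.
  rewrite sum1_count leqNgt; apply/negP => tj; apply: nt; exists j.
  exact: ltnW.
rewrite (bigID (pred1 j)) /= mulrC; apply: idealM => //.
rewrite (eq_bigr (fun=> y j)) => [|k /eqP->//].
rewrite big_const_seq iter_mulr_1 -(subnK tj) exprD; apply: idealM => //.
Qed.

(* Krull's intersection theorem for A/I.  An ideal L above I that is maximal
   among those avoiding a contains m a; as the chain (L : x^t) stabilizes, L then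
   contains a power of every x in m, hence some m^t. *)
Lemma krull m n (y : 'I_n -> A) I a : noetherian A -> local_ring m ->
  generators y m -> is_ideal I ->
  (forall t, exists2 b, I b & ideal_pow m t (a - b)) -> I a.
Proof.
move=> hN hm my idI aP; apply: contrapT => Ia.
have [/proper_ideal[idm m1] _] := proj1 hm.
have my_in j : m (y j) by rewrite my; apply: (@sub_span A A^o); exists j.
have [L [idL IL La Lmax]] := ideal_avoiding idI Ia.
(* By maximality of [L], the ideal L + A b, here [J], contains a. *)
have Lx b : ~ L b -> exists c, L (a - c * b).
  move=> Lb; pose J : set A := [set u | exists c, L (u - c * b)].
  have idJ : is_ideal J.
    apply/is_idealP; split; first by exists 0; rewrite mul0r subr0; exact: ideal0.
    move=> d u v [c Lu] [c' Lv]; exists (d * c + c').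
    rewrite mulrDl opprD addrACA -mulrA -mulrBr.
    by apply: idealD => //; exact: idealM.
  apply: contrapT => Ja; apply: Lb; rewrite -(Lmax J) //.
    by exists 1; rewrite mul1r subrr; exact: ideal0.
  by move=> u Lu; exists 0; rewrite mul0r subr0.
have mL x : m x -> L (x * a).
  (* Otherwise a is congruent to c x a modulo [L], where 1 - c x is a unit. *)
  move=> mx; apply: contrapT => /Lx[c].
  rewrite mulrA -{1}[a]mul1r -mulrBl => Lca.
  have [|u u1] := @local_unit m (1 - c * x) hm.
    move=> mcx; apply: m1; rewrite -[1](subrK (c * x)).
    by apply: idealD => //; exact: idealM.
  by apply: La; rewrite -[a]mul1r -u1 -mulrA; exact: idealM.
have Lpow x : m x -> exists t, L (x ^+ t).
  move=> mx; pose F t : set A := [set b | L (x ^+ t * b)].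
  have [|t|t tF] := @noetherian_chain F hN.
  - move=> t; apply/is_idealP; split; first by rewrite /F /= mulr0; exact: ideal0.
    move=> c u v Fu Fv; rewrite /F /= mulrDr mulrCA.
    by apply: idealD => //; exact: idealM.
  - by move=> b Fb; rewrite /F /= exprS -mulrA; exact: idealM.
  (* If a is congruent to c x^t modulo [L], then x a in [L] puts c in (L : x^(t+1)). By stability c
     lies in (L : x^t), and a falls into [L]. *)
  exists t; apply: contrapT => /Lx[c Lac]; apply: La.
  rewrite -[a](subrK (c * x ^+ t)); apply: idealD => //; rewrite mulrC.
  apply: tF; rewrite /F /= exprS -mulrA.
  have -> : x * (x ^+ t * c) = x * a - x * (a - c * x ^+ t).
    by rewrite mulrBr subKr [c * _]mulrC.
  by apply: idealB => //; [exact: mL | exact: idealM].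
have [i iL] := nilpotent_generators idL (fun j => Lpow _ (my_in j)).
have [b Ib ab] := aP i; apply: La; rewrite -[a](subrK b).
by apply: idealD => //; [apply: iL; rewrite -my | exact: IL].
Qed.
End IdealTheory.

(** * Generating families and bases of a module *)

Section Families.
Context (R : comNzRingType) (V : lmodType R).

Definition irredundant n (e : 'I_n -> V) : Prop :=
  forall j, ~ span (e @` [set i | i != j]) (e j).

Lemma min_family_irredundant n (e : 'I_n -> V) (N : set V) :
  span (range e) = N ->
  (forall k (f : 'I_k -> V), span (range f) = N -> (n <= k)%N) ->
  irredundant e.
Proof.
case: n e => [|n] e eN emin j; first by case: j.
move=> ej; suff /emin : span (range (fun i => e (lift j i))) = N by rewrite ltnn.
have le : span (e @` [set i | i != j]) `<=` span (range (fun i => e (lift j i))).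
  apply: span_mono => _ [i /= ij <-]; case: (unliftP j i) ij => [k ->|->].
    by exists k.
  by rewrite eqxx.
apply/seteqP; split.
  by rewrite -eN; apply: span_mono => _ [i _ <-]; exists (lift j i).
rewrite -eN; apply: span_min => _ [i _ <-]; apply: le.
have [->//|ij] := eqVneq i j; by apply: sub_span; exists i.
Qed.

Lemma exists_min_family (N : set V) :
  (exists s : seq V, span [set` s] = N) ->
  exists n (e : 'I_n -> V), span (range e) = N /\
    forall k (f : 'I_k -> V), span (range f) = N -> (n <= k)%N.
Proof.
move=> [s sN]; pose P n := `[< exists e : 'I_n -> V, span (range e) = N >].
have exP : exists n, P n.
  exists (size s); apply/asboolP; exists (fun i => s`_i); rewrite -sN.
  congr span; apply/seteqP; split=> [_ [i _ <-]|v /(nthP 0)[i si <-]].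
    exact: mem_nth.
  by exists (Ordinal si).
case: (ex_minnP exP) => n /asboolP[e eN] nmin; exists n, e; split=> // k f fN.
by apply: nmin; apply/asboolP; exists f.
Qed.

(** A basis is a set here, so the family must be injective: e_k = e_l with k different from l would
    give the relation e_k - e_l = 0 with coefficient 1 at k. *)
Lemma free_family n (e : 'I_n -> V) : span (range e) = setT ->
  (forall a : 'I_n -> R, \sum_k a k *: e k = 0 -> forall k, a k = 0) ->
  free_module V.
Proof.
move=> eT efree; exists (range e); split=> // s a us se sa0 v vs.
have e_inj : injective e.
  move=> k l ekl; apply: contrapT => /eqP kl.
  have d0 : \sum_i ((i == k)%:R - (i == l)%:R : R) *: e i = 0.
    under eq_bigr do rewrite scalerBl !scaler_nat !mulrb.
    by rewrite sumrB -!big_mkcond !big_pred1_eq ekl subrr.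
  have /eqP := efree _ d0 k.
  by rewrite eqxx (negPf kl) subr0 oner_eq0.
have [k _ kv] := se v vs.
have := efree (fun i => if e i \in s then a (e i) else 0) _ k.
rewrite kv vs; apply; rewrite -[RHS]sa0.
under eq_bigr do rewrite (fun_if (fun c => c *: _)) scale0r.
rewrite -big_mkcond -big_filter -(big_map e predT (fun v => a v *: v)).
apply: perm_big; apply: uniq_perm => //.
  by rewrite map_inj_uniq // filter_uniq // index_enum_uniq.
move=> u; apply/mapP/idP => [[i + ->]|us']; first by rewrite mem_filter => /andP[].
have [i _ iu] := se u us'; exists i => //.
by rewrite mem_filter iu us' mem_index_enum.
Qed.

(** A basis may be infinite, while [lin_indep] speaks of duplicate-free lists; this puts finitely
    many vectors on one such list so that their coordinates can be compared. *)
Lemma common_support n (B : set V) (w : 'I_n -> V) :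
  (forall i, span B (w i)) ->
  exists (s : seq V) (b : 'I_n -> V -> R), [/\ uniq s, forall v, v \in s -> B v &
    forall i, w i = \sum_(v <- s) b i v *: v].
Proof.
move=> /choice[t tP].
pose s := undup (flatten [seq unzip2 (t i) | i : 'I_n]).
exists s, (fun i v => \sum_(p <- t i | p.2 == v) p.1); split.
- exact: undup_uniq.
- move=> v; rewrite mem_undup => /flattenP[_ /mapP[i _ ->] /mapP[p pt ->]].
  exact: (proj1 (tP i)).
move=> i; rewrite [LHS](proj2 (tP i)).
under [RHS]eq_bigr do rewrite scaler_suml.
under [RHS]eq_bigr do rewrite big_mkcond.
rewrite exchange_big /= big_seq [RHS]big_seq; apply: eq_bigr => p pt.
rewrite -big_mkcond (big_rem p.2) /=; last first.
  rewrite mem_undup; apply/flattenP; exists (unzip2 (t i)); last exact: map_f.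
  by apply: map_f; rewrite mem_enum.
rewrite eqxx big1_seq ?addr0 // => v /andP[/eqP <-].
by rewrite rem_filter ?undup_uniq // mem_filter /= eqxx.
Qed.

End Families.

(** * Minimal generators and syzygies over a Noetherian local ring *)

Section LocalRing.
Context (A : comNzRingType) (m : set A).
Hypotheses (hN : noetherian A) (hm : local_ring m).

Let idm : is_ideal m. Proof. exact: (proj1 (proper_ideal (proj1 (proj1 hm)))). Qed.

(** A coefficient outside m is a unit and would express its vector through the others. *)
Lemma irredundant_coef (V : lmodType A) n (e : 'I_n -> V) (a : 'I_n -> A) :
  irredundant e -> \sum_k a k *: e k = 0 -> forall k, m (a k).
Proof.
move=> irr a0 k; apply: contrapT => /(local_unit hm)[b ba]; apply: (irr k).
have -> : e k = \sum_(i | i != k) (- (b * a i)) *: e i.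
  have /(congr1 (fun v => b *: v)) := a0; rewrite (bigD1 k) //= scaler0 scalerDr.
  rewrite scalerA ba scale1r => /eqP; rewrite addr_eq0 => /eqP->.
  rewrite scaler_sumr -sumrN; apply: eq_bigr => i _.
  by rewrite scalerA scaleNr.
by apply: span_sum => i ik; apply/spanZ/sub_span; exists i.
Qed.

Lemma min_generators_irredundant n (x : 'I_n -> A) (I : set A) :
  min_generators x I -> @irredundant A A^o n x.
Proof.
move=> [xI xmin] j xj; apply: (xmin j); rewrite xI; apply/seteqP; split.
  apply: (@span_min A A^o) => _ [i _ <-]; have [->//|ij] := eqVneq i j.
  by apply: (@sub_span A A^o); exists i.
by apply: (@span_mono A A^o) => _ [i _ <-]; exists i.
Qed.

Lemma exists_min_generators (I : set A) : is_ideal I ->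
  exists n (x : 'I_n -> A), generators x I /\
    forall k (y : 'I_k -> A), generators y I -> (n <= k)%N.
Proof.
move=> /hN[s sI]; have [|n [x [xI xmin]]] := @exists_min_family A A^o I.
  by exists s.
exists n, x; split=> [|k y yI]; first exact: esym.
by apply: (xmin k y); rewrite yI.
Qed.

Lemma irredundant_min_generators n (x : 'I_n -> A) (I : set A) :
  generators x I -> @irredundant A A^o n x -> min_generators x I.
Proof.
move=> xI irr; split=> // j xj; apply: (irr j).
change (ideal_span (x @` [set i | i != j]) (x j)).
by rewrite -xj xI; apply: (@sub_span A A^o); exists j.
Qed.

Lemma min_size_min_generators n (x : 'I_n -> A) (I : set A) :
  generators x I -> (forall k (y : 'I_k -> A), generators y I -> (n <= k)%N) ->
  min_generators x I.
Proof.
move=> xI xmin; apply: irredundant_min_generators => //.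
apply: (@min_family_irredundant A A^o n x I); first exact: esym.
by move=> k y yI; apply: (xmin k y); rewrite -yI.
Qed.

Lemma edim_generators : exists y : 'I_(edim m) -> A, min_generators y m.
Proof.
have [n [x [xm xmin]]] := exists_min_generators idm.
(* The set defining [min_ngen] is nonempty since m is finitely generated, so the default value 0 is
   not what [xget] returns by accident. *)
have [[y ym] ymin] : (exists y : 'I_(edim m) -> A, generators y m) /\
    forall k (y : 'I_k -> A), generators y m -> (edim m <= k)%N.
  apply: (@xgetPex _ 0%N [set n | (exists y : 'I_n -> A, generators y m) /\
    forall k (y : 'I_k -> A), generators y m -> (n <= k)%N]); exists n.
  by split=> //; exists x.
by exists y; exact: min_size_min_generators.
Qed.

Lemma indep_seqP (M : lmodType A) n (x : 'I_n -> A) :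
  indep_seq M x <-> indep_on x M.
Proof.
by split=> xM w w0 i; have /smul_rangeTP := xM w w0 i.
Qed.

(** In a basis of M, each coordinate of a relation is a scalar relation between minimal generators
    of [I], so its coefficients lie in m. Applied to the powers of m, this makes m strongly
    independent. *)
Lemma free_rel_submod (M : lmodType A) (I : set A) :
  free_module M -> @rel_submod A M I `<=` smul m setT.
Proof.
move=> [B [Bfree BT]]; apply: span_min => _ [n [x [w [xI w0 [j _ <-]]]]].
have [|s [b [us sB wE]]] := @common_support A M n B w; first by rewrite BT.
rewrite wE big_seq; apply: span_sum => v vs; apply: sub_span.
exists (b j v); last by exists v.
apply: (@irredundant_coef A^o n x (b ^~ v) (min_generators_irredundant xI)).
apply: (Bfree s (fun u => \sum_i b i u * x i) us sB _ v vs).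
under eq_bigr do rewrite scaler_suml.
rewrite exchange_big -[RHS]w0; apply: eq_bigr => i _.
rewrite wE scaler_sumr; apply: eq_bigr => u _.
by rewrite scalerA mulrC.
Qed.

(** Minimal generators of m are linearly independent in m/m^2 over the residue field. *)
Lemma min_generators_coef_sqr n (y b : 'I_n -> A) : min_generators y m ->
  ideal_pow m 2 (\sum_i b i * y i) -> forall i, m (b i).
Proof.
move=> ym; rewrite {1}/ideal_pow iterS -/(ideal_pow m 1) ideal_pow1 // /ideal_mul.
rewrite {1}(proj1 ym).
move=> /(@smul_rangeP A A^o n y m _ (ideal_span_id idm))[v [mv bv]] i.
rewrite -(subrK (v i) (b i)); apply: idealD => //.
apply: (@irredundant_coef A^o n y (fun i => b i - v i)).
  exact: min_generators_irredundant ym.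
under eq_bigr do rewrite scalerBl.
rewrite sumrB [X in X - _]bv; apply/eqP; rewrite subr_eq0; apply/eqP.
by apply: eq_bigr => k _; exact: mulrC.
Qed.

(** In a basis of M/m^2 M, the lifted coordinates of the [w j] satisfy scalar relations modulo m^2,
    hence lie in m. So each [w i] is in mM + m^2 M = mM. *)
Lemma quot_free_indep (M : lmodType A) n (y : 'I_n -> A)
    (h2 : is_proper_ideal (ideal_pow m 2)) :
  free_module (quot_mod M h2) -> min_generators y m -> indep_on y M.
Proof.
move=> [B [Bfree BT]] ym w w0 i.
have [|s [b [us sB wE]]] :=
  @common_support _ (quot_mod M h2) n B (fun i => quot_mod_pi h2 (w i)).
  by move=> j; rewrite BT.
have [beta betaE] : exists beta : 'I_n -> quot_mod M h2 -> A,
    forall j v, quot_ring_pi h2 (beta j v) = b j v.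
  have [f fP] := choice (fun p : 'I_n * quot_mod M h2 =>
    quot_ring_pi_surj (b p.1 p.2)).
  by exists (fun j v => f (j, v)) => j v; exact: (fP (j, v)).
have [g gP] := choice (@quot_mod_pi_surj A _ M h2).
have mb v : v \in s -> forall j, m (beta j v).
  move=> vs; apply: (min_generators_coef_sqr ym); apply/(quot_ring_pi_eq0 h2).
  rewrite rmorph_sum.
  have := Bfree s (fun u => \sum_j quot_ring_pi h2 (beta j u * y j)) us sB.
  apply=> //; under eq_bigr do rewrite scaler_suml.
  rewrite exchange_big -[RHS](raddf0 (quot_mod_pi h2)) -w0 raddf_sum.
  apply: eq_bigr => j _; rewrite /= quot_mod_piZ wE scaler_sumr.
  by apply: eq_bigr => u _; rewrite rmorphM /= betaE scalerA mulrC.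
apply/smul_rangeTP; rewrite -(proj1 ym).
rewrite -(subrK (\sum_(v <- s) beta i v *: g v) (w i)).
apply: spanD; last first.
  rewrite big_seq; apply: span_sum => v vs; apply: sub_span.
  by exists (beta i v); [exact: mb|exists (g v)].
have : smul (ideal_pow m 2) setT (w i - \sum_(v <- s) beta i v *: g v).
  apply/(quot_mod_pi_eq0 h2); rewrite raddfB /= wE raddf_sum.
  apply/eqP; rewrite subr_eq0; apply/eqP; apply: eq_bigr => v _.
  by rewrite /= quot_mod_piZ betaE gP.
apply: span_min => _ [a a2 [v _ <-]]; apply: sub_span; exists a; last by exists v.
move: a2; apply: ideal_span_min => // _ [c mc [d _ <-]].
by rewrite [_ *: _]mulrC; exact: idealM.
Qed.

Lemma syzygy_descent (M : lmodType A) n (x y : 'I_n -> A) r (e : 'I_r -> M)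
    (c : 'I_r -> A) :
  generators y m -> (forall i, m (x i)) -> indep_on x M ->
  span (range e) = setT -> irredundant e -> \sum_k c k *: e k = 0 ->
  exists a b : 'I_n -> 'I_r -> A,
    [/\ forall j, \sum_k a j k *: e k = 0,
        forall j k, ideal_span (range x) (b j k) &
        forall k, c k = \sum_j y j * (a j k + b j k)].
Proof.
move=> ym mx xM eT irr c0.
have coord v : exists a : 'I_r -> A, v = \sum_k a k *: e k.
  by apply/span_rangeP; rewrite eT.
have ymP a : m a -> exists d : 'I_n -> A, a = \sum_j d j * y j.
  by rewrite {1}ym => /ideal_span_rangeP.
have [al alE] := choice (fun k => ymP _ (irredundant_coef irr c0 k)).
have [d dE] := choice (fun i => ymP _ (mx i)).
have w0 : \sum_j y j *: (\sum_k al k j *: e k) = 0.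
  under eq_bigr do rewrite scaler_sumr.
  rewrite exchange_big -[RHS]c0; apply: eq_bigr => k _; rewrite alE scaler_suml.
  by apply: eq_bigr => j _; rewrite scalerA mulrC.
have [s /choice[v vE]] := koszul_cycle dE xM w0.
(* With one lift per ordered pair, the lift of s j l - s l j stays antisymmetric. Hence the sum of
   the y_j u_jk is zero, and removing [u] does not change [c k]. *)
have [sg sgE] := choice (fun p : 'I_n * 'I_n => coord (s p.1 p.2)).
have [nu nuE] := choice (fun p : 'I_n * 'I_n => coord (v p.1 p.2)).
pose b j k := \sum_i nu (j, i) k * x i.
pose u j k := \sum_l y l * (sg (j, l) k - sg (l, j) k).
exists (fun j k => al k j - u j k - b j k), b; split.
- move=> j; under eq_bigr do rewrite !scalerBl.
  rewrite !sumrB vE; apply/eqP; rewrite subr_eq0 subr_eq; apply/eqP.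
  rewrite addrC; congr (_ + _).
    under [RHS]eq_bigr do rewrite scaler_suml.
    rewrite exchange_big; apply: eq_bigr => i _.
    rewrite (nuE (j, i)) scaler_sumr; apply: eq_bigr => k _.
    by rewrite scalerA mulrC.
  under [RHS]eq_bigr do rewrite scaler_suml.
  rewrite exchange_big; apply: eq_bigr => l _.
  rewrite (sgE (j, l)) (sgE (l, j)) -sumrB scaler_sumr; apply: eq_bigr => k _.
  by rewrite -scalerBl scalerA.
- by move=> j k; apply/ideal_span_rangeP; exists (fun i => nu (j, i) k).
move=> k; under eq_bigr do rewrite subrK mulrBr.
rewrite sumrB (_ : \sum_i y i * u i k = 0); last first.
  under eq_bigr => j _.
    rewrite mulr_sumr; under eq_bigr do rewrite mulrA mulrBr.
    rewrite sumrB; over.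
  rewrite sumrB [X in _ - X]exchange_big /=; apply/eqP; rewrite subr_eq0; apply/eqP.
  by apply: eq_bigr => j _; apply: eq_bigr => l _; rewrite [y l * _]mulrC.
by rewrite subr0 alE; apply: eq_bigr => j _; rewrite mulrC.
Qed.

(** The classes of the [e k] form a basis. A relation modulo m^2 M becomes a true one after a change
    of coefficients by elements of m^2, and [syzygy_descent] then places its coefficients in m^2. *)
Lemma indep_quot_free (M : lmodType A) n (x y : 'I_n -> A) r (e : 'I_r -> M)
    (h2 : is_proper_ideal (ideal_pow m 2)) :
  generators y m -> (forall i, m (x i)) -> indep_on x M ->
  span (range e) = setT -> irredundant e -> free_module (quot_mod M h2).
Proof.
move=> ym mx xM eT irr.
have my j : m (y j) by rewrite ym; apply: (@sub_span A A^o); exists j.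
have xm : ideal_span (range x) `<=` m by apply: ideal_span_min => // _ [i _ <-].
have id2 := ideal_pow_ideal m 2.
apply: (@free_family _ _ r (fun k => quot_mod_pi h2 (e k))).
  apply/seteqP; split=> // q _; have [v <-] := quot_mod_pi_surj q.
  have /span_rangeP[a ->] : span (range e) v by rewrite eT.
  apply/span_rangeP; exists (fun k => quot_ring_pi h2 (a k)).
  by rewrite raddf_sum; apply: eq_bigr => k _; rewrite /= quot_mod_piZ.
move=> a; have [al alE] := choice (fun k => quot_ring_pi_surj (a k)).
move=> a0 k; rewrite -alE; apply/(quot_ring_pi_eq0 h2).
have : smul (ideal_pow m 2) setT (\sum_k al k *: e k).
  apply/(quot_mod_pi_eq0 h2); rewrite -[RHS]a0 raddf_sum; apply: eq_bigr => i _.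
  by rewrite /= quot_mod_piZ alE.
move=> /(smul_gen eT (ideal_span_id id2))[b [b2 ab]].
rewrite -(subrK (b k) (al k)); apply: idealD => //.
have c0 : \sum_k (al k - b k) *: e k = 0.
  by under eq_bigr do rewrite scalerBl; rewrite sumrB ab subrr.
have [a' [b' [a'0 b'x ->]]] := syzygy_descent ym mx xM eT irr c0.
apply: ideal_sum => // j _; apply: ideal_powS => //; rewrite ideal_pow1 //.
by apply: idealD => //; [exact: irredundant_coef (a'0 j) k | exact: xm].
Qed.

Lemma syzygy_in_indep_ideal (M : lmodType A) n (x y : 'I_n -> A) r
    (e : 'I_r -> M) (c : 'I_r -> A) :
  generators y m -> (forall i, m (x i)) -> indep_on x M ->
  span (range e) = setT -> irredundant e -> \sum_k c k *: e k = 0 ->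
  forall k, ideal_span (range x) (c k).
Proof.
move=> ym mx xM eT irr c0 k; have idI := ideal_span_ideal (range x).
have my j : m (y j) by rewrite ym; apply: (@sub_span A A^o); exists j.
apply: (krull hN hm ym idI) => t.
(* The induction covers all relations at once, since it is applied to the rows [a j]; the factors
   y_j in m then raise the power of m by one. *)
elim: t c c0 k => [|t IHt] c c0 k; first by exists 0 => //; exact: ideal0.
have [a [b [a0 bx ->]]] := syzygy_descent ym mx xM eT irr c0.
have [b' b'x ab'] : exists2 b' : 'I_n -> A, forall j, ideal_span (range x) (b' j) &
    forall j, ideal_pow m t (a j k - b' j).
  have /choice[b' b'P] : forall j, exists b', ideal_span (range x) b' /\
      ideal_pow m t (a j k - b').
    by move=> j; have [d dx ad] := IHt _ (a0 j) k; exists d.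
  by exists b' => j; have [] := b'P j.
exists (\sum_j y j * (b' j + b j k)).
  by apply: ideal_sum => // j _; apply: idealM => //; exact: idealD.
rewrite -sumrB; apply: ideal_sum => [|j _]; first exact: ideal_pow_ideal.
rewrite -mulrBr opprD addrACA subrr addr0.
exact: ideal_powS.
Qed.

Lemma strongly_indep_free (M : lmodType A) n (x y : 'I_n -> A) r (e : 'I_r -> M) :
  generators y m -> (forall i, m (x i)) -> strongly_indep_seq M x ->
  span (range e) = setT -> irredundant e -> free_module M.
Proof.
move=> ym mx [I [xI [idI strong]]] eT irr.
have IE : I = ideal_span (range x) := proj1 xI.
have Im : I `<=` m by rewrite IE; apply: ideal_span_min => // _ [i _ <-].
have xM : indep_on x M.
  move=> w w0 i; apply/smul_rangeTP; rewrite -IE; apply: (strong 1%N) => //.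
  by rewrite ideal_pow1 //; apply: sub_span; exists n, x, w; split=> //; exists i.
(* In other words, M/IM is free over A/I on the classes of the [e k]. *)
have relI a : smul I setT (\sum_k a k *: e k) -> forall k, I (a k).
  move=> /(smul_gen eT (ideal_span_id idI))[b [bI ab]] k.
  rewrite -(subrK (b k) (a k)); apply: idealD => //; rewrite IE.
  apply: (syzygy_in_indep_ideal (c := fun k => a k - b k) ym mx xM eT irr).
  by under eq_bigr do rewrite scalerBl; rewrite sumrB ab subrr.
apply: (free_family eT) => c c0.
have cI t k : ideal_pow I t.+1 (c k).
  elim: t k => [|t IHt] k.
    by rewrite ideal_pow1 //; apply: relI; rewrite c0; exact: span0.
  (* Expanding the [c k] in minimal generators z_j of I^(t+1) turns the given relation into one
     between the z_j. Strong independence puts its terms in IM, and [relI] puts the coefficients of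
     the z_j in I. *)
  have [p [z [zI zmin]]] := exists_min_generators (ideal_pow_ideal I t.+1).
  have zmg := min_size_min_generators zI zmin.
  have /choice[al alE] : forall k, exists a : 'I_p -> A, c k = \sum_j a j * z j.
    by move=> i; apply/ideal_span_rangeP; rewrite -zI.
  rewrite alE; apply: ideal_sum => [|j _]; first exact: ideal_pow_ideal.
  apply: ideal_powS; last by rewrite zI; apply: (@sub_span A A^o); exists j.
  apply: relI (al ^~ j) _ k; apply: (strong t.+1) => //; apply: sub_span.
  exists p, z, (fun j => \sum_k al k j *: e k); split=> //.
  under eq_bigr do rewrite scaler_sumr.
  rewrite exchange_big -[RHS]c0; apply: eq_bigr => i _; rewrite alE scaler_suml.
  by apply: eq_bigr => l _; rewrite scalerA mulrC.
(* Krull's theorem for the zero ideal: [c k] lies in every power of I, hence of m. *)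
move=> k; apply: (krull (I := [set 0]) hN hm ym).
  by apply/is_idealP; split=> // a _ _ -> ->; rewrite mulr0 addr0.
move=> t; exists 0; rewrite // subr0; apply: (ideal_pow_mono Im).
by case: t.
Qed.

End LocalRing.

Theorem theorem1p2 (A : comNzRingType) (m : set A) (hN : noetherian A)
    (hm : local_ring m) (M : lmodType A) (hM : fin_gen_module M) :
  (free_module M <->
     exists x : 'I_(edim m) -> A,
       (forall i, m (x i)) /\ strongly_indep_seq M x) /\
  (free_module (quot_mod M (maximal_ideal_sqr_proper (proj1 hm))) <->
     exists x : 'I_(edim m) -> A,
       (forall i, m (x i)) /\ indep_seq M x).
Proof.
have [y ym] := edim_generators hN hm.
have my j : m (y j) by rewrite (proj1 ym); apply: (@sub_span A A^o); exists j.
have [r [e [eT emin]]] := exists_min_family hM.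
have irr := min_family_irredundant eT emin.
have [idm _] := proper_ideal (proj1 (proj1 hm)).
split; split.
(* Both forward implications take a minimal system of generators of m as the sequence; here the
   strongly independent ideal is m itself. *)
- move=> Mfree; exists y; split=> //; exists m; split=> //; split=> // i _.
  exact: free_rel_submod.
- move=> [x [mx xstr]]; exact: strongly_indep_free (proj1 ym) mx xstr eT irr.
- move=> Mfree; exists y; split=> //; apply/indep_seqP.
  exact: quot_free_indep Mfree ym.
- move=> [x [mx /indep_seqP xM]].
  exact: indep_quot_free (proj1 ym) mx xM eT irr.
Qed.
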